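(* Let $\mathcal{M}$ and $\mathcal{N}$ be von Neumann algebras equipped with normal faithful states $\phi$ and $\psi$. Let $T\colon\mathcal{M}\to\mathcal{N}$ be a $(\phi,\psi)$-Markov map. Then $$\mathrm{LMD}(T)=\mathrm{RMD}(T)=\mathrm{MD}(T)=\mathrm{Fix}(T^*\circ T).$$
   Context: A linear map $T\colon\mathcal{M}\to\mathcal{N}$ is a $(\phi,\psi)$-Markov map if it is completely positive, unital, $\psi\circ T=\phi$, and $T\circ\sigma^\phi_t=\sigma^\psi_t\circ T$ for all $t\in\mathbb{R}$, where $(\sigma^\phi_t)$, $(\sigma^\psi_t)$ are the modular automorphism groups of $\phi$, $\psi$. For such $T$ there is a unique completely positive unital map $T^*\colon\mathcal{N}\to\mathcal{M}$ with $\phi(T^*(y)x)=\psi(yT(x))$ for all $x\in\mathcal{M}$, $y\in\mathcal{N}$. $\mathrm{LMD}(T)=\{x\in\mathcal{M}:T(xy)=T(x)T(y)\ \text{for all }y\in\mathcal{M}\}$, $\mathrm{RMD}(T)=\{x\in\mathcal{M}:T(yx)=T(y)T(x)\ \text{for all }y\in\mathcal{M}\}$, $\mathrm{MD}(T)=\mathrm{LMD}(T)\cap\mathrm{RMD}(T)$, and for $S\colon\mathcal{M}\to\mathcal{M}$, $\mathrm{Fix}(S)=\{x\in\mathcal{M}:S(x)=x\}$. *)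

(* Defs.v *)
From HB Require Import structures.
From mathcomp Require Import all_boot all_order all_algebra.
From mathcomp Require Import complex.
From mathcomp Require Import all_classical all_reals all_analysis.
Set Implicit Arguments.
Unset Strict Implicit.
Unset Printing Implicit Defensive.
Import Order.TTheory GRing.Theory Num.Theory.
Import numFieldNormedType.Exports.
Local Open Scope classical_set_scope.
Local Open Scope ring_scope.
Local Open Scope complex_scope.

(* The scalars are R[i]; its topology and its module structure over itself are
   carried by the alias R[i]^o. *)

(* [dot H for conjC]: linear in the first argument, conjugate-linear in the
   second one, Hermitian and positive definite. *)
Record hilbertSpace (R : realType) := HilbertSpace {
  hilbert_sort :> completeNormedModType R[i];
  inner : {dot hilbert_sort for Num.conj};
  inner_normE : forall u : hilbert_sort, inner u u = `|u| ^+ 2 }.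

Section Operators.
Context {R : realType} {H : hilbertSpace R}.
Implicit Types (a b : H -> H) (S M : set (H -> H)).

(* Operators are plain functions: sums and scalings are pointwise, the product
   is composition, and the unit is idfun. *)
Definition bounded_op : set (H -> H) := [set a | linear a /\ continuous a].

(* The adjoint is kept as a relation: b is the adjoint a^* of a. *)
Definition is_adjoint a b :=
  forall u v : H, inner H (a u) v = inner H u (b v).

Definition op_ge0 a := forall u : H, 0 <= inner H (a u) u.

Definition op_le a b := op_ge0 (b - a).

Definition commutant S : set (H -> H) :=
  [set a | bounded_op a /\ forall b, S b -> a \o b = b \o a].

(* By the bicommutant condition, M is a unital subalgebra. *)
Definition von_neumann_algebra M :=
  [/\ M `<=` bounded_op,
      (forall a, M a -> exists2 b, M b & is_adjoint a b)
    & commutant (commutant M) = M].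

Definition selfadjoint_part M : set (H -> H) :=
  [set a | M a /\ is_adjoint a a].

Definition op_directed (D : set (H -> H)) :=
  D !=set0 /\
  forall a b, D a -> D b -> exists c, [/\ D c, op_le a c & op_le b c].

Definition op_ubound (D : set (H -> H)) a := forall b, D b -> op_le b a.

Definition op_lub_in M (D : set (H -> H)) a :=
  [/\ selfadjoint_part M a, op_ubound D a
    & forall b, selfadjoint_part M b -> op_ubound D b -> op_le a b].

(* Positivity of an n x n matrix of operators, acting on H^n. *)
Definition mx_op_ge0 n (A : 'M[H -> H]_n) :=
  forall u : 'I_n -> H, 0 <= \sum_i \sum_j inner H (A i j (u j)) (u i).

End Operators.

(* Maps on an algebra of operators are total functions of which only the
   restriction to the algebra matters, hence the relativized notions below. *)
Definition linear_on (K : numDomainType) (U V : lmodType K) (A : set U)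
    (f : U -> V) :=
  forall (c : K) (x y : U), A x -> A y -> f (c *: x + y) = c *: f x + f y.

Section States.
Context {R : realType} {H : hilbertSpace R}.
Implicit Types (M : set (H -> H)) (phi : (H -> H) -> R[i]^o).

Definition is_state M phi :=
  [/\ linear_on M phi,
      (forall a, M a -> op_ge0 a -> 0 <= phi a)
    & phi idfun = 1].

(* phi preserves least upper bounds of upward directed sets. As phi is monotone
   on M, phi a is an upper bound of the values of phi on D; only minimality has
   to be required. In the order of R[i], an upper bound of a nonempty set of
   reals is real. *)
Definition is_normal M phi :=
  forall (D : set (H -> H)) (a : H -> H),
    D `<=` selfadjoint_part M -> op_directed D -> op_lub_in M D a ->
    forall r : R[i], (forall b, D b -> phi b <= r) -> phi a <= r.

Definition is_faithful M phi :=
  forall a, M a -> op_ge0 a -> phi a = 0 -> a = 0.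

Definition normal_faithful_state M phi :=
  [/\ is_state M phi, is_normal M phi & is_faithful M phi].

Definition star_automorphism M (alpha : (H -> H) -> (H -> H)) :=
  [/\ set_bij M M alpha,
      linear_on M alpha,
      (forall a b, M a -> M b -> alpha (a \o b) = alpha a \o alpha b)
    & (forall a b, M a -> M b -> is_adjoint a b ->
         is_adjoint (alpha a) (alpha b))].

(* Continuity in t is for the weak operator topology, which agrees with the
   sigma-weak one on bounded sets. *)
Definition automorphism_group M (sigma : R -> (H -> H) -> (H -> H)) :=
  [/\ (forall t, star_automorphism M (sigma t)),
      (forall a, M a -> sigma 0 a = a),
      (forall s t a, M a -> sigma (s + t) a = sigma s (sigma t a))
    & (forall a (u v : H), M a ->
         continuous ((fun t => inner H (sigma t a u) v) : R -> R[i]^o))].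

(* The KMS function of a pair (a, b): bounded and continuous on the closed
   strip 0 <= Im z <= 1, holomorphic inside; derivable along 1 over the field
   R[i] is complex differentiability. *)
Definition kms_function phi (sigma : R -> (H -> H) -> (H -> H))
    (a b : H -> H) (F : R[i]^o -> R[i]^o) :=
  [/\ {within [set z : R[i]^o | 0 <= complex.Im z <= 1], continuous F},
      (exists B : R[i], forall z, 0 <= complex.Im z <= 1 -> `|F z| <= B),
      (forall z : R[i]^o, 0 < complex.Im z < 1 -> derivable F z 1),
      (forall t : R, F (t +i* 0) = phi (sigma t a \o b))
    & (forall t : R, F (t +i* 1) = phi (b \o sigma t a))].

(* sigma is the modular automorphism group of phi: the (unique) one-parameter
   automorphism group of M satisfying the modular (KMS) condition for phi. *)
Definition modular_group M phi (sigma : R -> (H -> H) -> (H -> H)) :=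
  [/\ automorphism_group M sigma,
      (forall t a, M a -> phi (sigma t a) = phi a)
    & (forall a b, M a -> M b -> exists F, kms_function phi sigma a b F)].

End States.

Section Maps.
Context {R : realType} {H K : hilbertSpace R}.
Implicit Types (M : set (H -> H)) (N : set (K -> K)).
Implicit Types (T : (H -> H) -> (K -> K)).

Definition completely_positive M T :=
  forall n (A : 'M[H -> H]_n), (forall i j, M (A i j)) ->
    mx_op_ge0 A -> mx_op_ge0 (map_mx T A).

Definition ucp_map M N T :=
  [/\ set_fun M N T, linear_on M T, completely_positive M T
    & T idfun = idfun].

(* sphi and spsi stand for the modular automorphism groups of phi and psi. *)
Definition markov_map M N (phi : (H -> H) -> R[i]^o) (psi : (K -> K) -> R[i]^o)
    (sphi : R -> (H -> H) -> (H -> H)) (spsi : R -> (K -> K) -> (K -> K)) T :=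
  [/\ ucp_map M N T,
      (forall a, M a -> psi (T a) = phi a)
    & (forall t a, M a -> T (sphi t a) = spsi t (T a))].

Definition LMD M T : set (H -> H) :=
  [set x | M x /\ forall y, M y -> T (x \o y) = T x \o T y].

Definition RMD M T : set (H -> H) :=
  [set x | M x /\ forall y, M y -> T (y \o x) = T y \o T x].

Definition MD M T : set (H -> H) := LMD M T `&` RMD M T.

Definition Fix M (f : (H -> H) -> (H -> H)) : set (H -> H) :=
  [set x | M x /\ f x = x].

End Maps.

(* Ts is the map T^* : N -> M. *)
Definition markov_adjoint (R : realType) (H K : hilbertSpace R)
    (M : set (H -> H)) (N : set (K -> K))
    (phi : (H -> H) -> R[i]^o) (psi : (K -> K) -> R[i]^o)
    (T : (H -> H) -> (K -> K)) (Ts : (K -> K) -> (H -> H)) :=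
  ucp_map N M Ts /\
  forall x y, M x -> N y -> phi (Ts y \o x) = psi (y \o T x).

(* Main.v *)
(* Write x^s for the adjoint of x. The Kadison-Schwarz defect
   D(x,y) = T(x^s y) - T(x)^s T(y) is a positive sesquilinear form, so
   D(x,x) = 0 forces D(x,y) = D(y,x) = 0 for all y. Hence x^s in LMD, x in RMD
   and D(x,x) = 0 are equivalent.
   If T^*T x = x then psi(T(x x^s)) = phi(x x^s) = phi(T^*T(x) x^s) =
   psi(T(x) T(x^s)), so that D(x^s,x^s) = 0 as psi is faithful. Conversely, if
   x is in LMD then phi(T^*T(x) y) = psi(T(x) T(y)) = psi(T(x y)) = phi(x y)
   for all y, and phi is faithful. Since the fixed points are stable under the
   involution, all the sets agree. *)
Require Import Defs.
From mathcomp Require Import all_boot all_order all_algebra.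
From mathcomp Require Import complex.
From mathcomp Require Import all_classical all_reals all_analysis.
From mathcomp Require Import ring.
Import Order.TTheory GRing.Theory Num.Theory.
Import numFieldNormedType.Exports.
Local Open Scope classical_set_scope.
Local Open Scope ring_scope.
Local Open Scope complex_scope.

(** * Scalar consequences of positivity of forms *)

Section ComplexPositivity.
Variable C : numClosedFieldType.
Implicit Types p q r z : C.

(** As ['i] is conjugated to [- 'i], the second condition reads q - p = conj p - conj q; adding the
    first gives 2q = 2 conj p. *)
Lemma conj_of_real p q :
  p + q \is Num.real -> 'i * (q - p) \is Num.real -> q = Num.conj p.
Proof.
move=> /CrealP pqR /CrealP; rewrite rmorphM rmorphB /= conjCi => qpR.
rewrite rmorphD /= in pqR.
have {}qpR : q - p = Num.conj p - Num.conj q.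
  by apply: (mulfI (neq0Ci C)); rewrite -qpR; ring.
apply: (@mulfI _ 2); first by rewrite pnatr_eq0.
by rewrite (_ : 2 * q = (p + q) + (q - p)); [rewrite -pqR qpR; ring | ring].
Qed.

Lemma ge0_affine_eq0 z r :
  (forall t : C, t \is Num.real -> 0 <= t * z + r) -> z = 0.
Proof.
move=> h; apply/eqP/negPn/negP => z0.
have r0 : 0 <= r by have := h 0 (real0 C); rewrite mul0r add0r.
have zR : z \is Num.real.
  have /ger0_real := h 1 (real1 C); rewrite mul1r => zr.
  by rewrite -(addrK r z) rpredB // ger0_real.
(* At this real t the affine expression takes the value -1. *)
have tR : - (r + 1) / z \is Num.real.
  by rewrite rpredM ?realV // realN rpredD ?real1 ?ger0_real.
have := h _ tR; rewrite divfK // opprD addrAC addNr add0r.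
by rewrite oppr_ge0 ler10.
Qed.

(** Real c makes p + q vanish, and purely imaginary c makes p - q vanish. *)
Lemma ge0_sesqui_affine_eq0 p q r :
  (forall c : C, 0 <= c * p + Num.conj c * q + r) -> p = 0 /\ q = 0.
Proof.
move=> h.
have pq : p + q = 0.
  apply: (ge0_affine_eq0 _ r) => t /CrealP tR.
  by have := h t; rewrite tR -mulrDr.
have qp : 'i * (p - q) = 0.
  apply: (ge0_affine_eq0 _ r) => t /CrealP tR.
  have := h (t * 'i); rewrite rmorphM /= conjCi tR.
  by rewrite mulrN mulNr mulrBr mulrBr !mulrA.
have {}qp : p = q.
  by apply/eqP; rewrite -subr_eq0 -(mulrI_eq0 _ (mulfI (neq0Ci C))) qp.
have p0 : p = 0.
  apply: (@mulfI _ 2); first by rewrite pnatr_eq0.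
  by rewrite mulr0 -pq -qp; ring.
by split=> //; rewrite -qp.
Qed.

End ComplexPositivity.

(** * Adjoints, commutants and von Neumann algebras *)

Section Adjoints.
Context {R : realType} {H : hilbertSpace R}.
Implicit Types (a b c d : H -> H) (S M : set (H -> H)) (u v : H).

Lemma innerC u v : inner H u v = Num.conj (inner H v u).
Proof. by rewrite (hermC (inner H) u v) /= expr0 mul1r. Qed.

Lemma inner_eq u v : (forall w, inner H u w = inner H v w) -> u = v.
Proof.
move=> uv; apply/eqP; rewrite -subr_eq0 -(dnorm_eq0 (inner H)).
by rewrite linearBl /= uv subrr.
Qed.

Lemma is_adjoint_sym a b : is_adjoint a b -> is_adjoint b a.
Proof. by move=> ab u v; rewrite innerC -ab -innerC. Qed.

Lemma is_adjoint_unique a b c : is_adjoint b a -> is_adjoint c a -> b = c.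
Proof.
by move=> ba ca; apply/funext => u; apply: inner_eq => v; rewrite ba ca.
Qed.

Lemma op_ge0_comp_adjoint a b : is_adjoint a b -> op_ge0 (a \o b).
Proof. by move=> ab u /=; rewrite ab dnorm_ge0. Qed.

Lemma comp_adjoint_eq0 a b : is_adjoint a b -> a \o b = 0 -> a = 0.
Proof.
move=> ab ab0.
have b0 u : b u = 0.
  apply/eqP; rewrite -(dnorm_eq0 (inner H)) -ab.
  by rewrite -[a (b u)]/((a \o b) u) ab0 linear0l.
by apply/funext => u; apply: inner_eq => v; rewrite ab b0 linear0r linear0l.
Qed.

Lemma commutant_comp S a b :
  commutant S a -> commutant S b -> commutant S (a \o b).
Proof.
move=> [[la ca] aS] [[lb cb] bS]; split; [split|].
- by move=> k u v; rewrite /= lb la.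
- by move=> u; apply: continuous_comp; [exact: cb | exact: ca].
- move=> s Ss; rewrite -compA bS // compA aS //.
Qed.

Lemma commutantB S a b :
  S `<=` bounded_op -> commutant S a -> commutant S b -> commutant S (a - b).
Proof.
move=> Sb [[la ca] aS] [[lb cb] bS]; split; [split|].
- move=> k u v; change (a (k *: u + v) - b (k *: u + v) =
    k *: (a u - b u) + (a v - b v)).
  by rewrite la lb scalerBr opprD addrACA.
- by move=> u; apply: continuousB; [exact: ca | exact: cb].
- move=> s Ss; apply/funext => u.
  have [ls _] := Sb _ Ss.
  have sB x y : s (x - y) = s x - s y.
    by have := ls (-1) y x; rewrite !scaleN1r ![- _ + _]addrC.
  change (a (s u) - b (s u) = s (a u - b u)).
  rewrite sB -[a (s u)]/((a \o s) u) aS //.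
  by rewrite -[b (s u)]/((b \o s) u) bS.
Qed.

Lemma commutant_id S : commutant S idfun.
Proof. by split=> //; split=> // u; exact: cvg_id. Qed.

Section VonNeumannAlgebra.
Context (M : set (H -> H)) (Mvn : von_neumann_algebra M).

Lemma vn_id : M idfun.
Proof. by case: Mvn => _ _ <-; exact: commutant_id. Qed.

Lemma vn_comp a b : M a -> M b -> M (a \o b).
Proof. by case: Mvn => _ _ <-; exact: commutant_comp. Qed.

Lemma vnB a b : M a -> M b -> M (a - b).
Proof. by case: Mvn => _ _ <-; apply: commutantB => s []. Qed.

Lemma vn_linear a : M a -> linear a.
Proof. by case: Mvn => + _ _ Ma => /(_ _ Ma)[]. Qed.

Lemma vn_op0 a : M a -> a 0 = 0.
Proof.
by move=> /vn_linear/(_ (-1) 0 0); rewrite scaler0 addr0 scaleN1r addNr.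
Qed.

Lemma vn_opZ a (k : R[i]) u : M a -> a (k *: u) = k *: a u.
Proof.
by move=> Ma; have := vn_linear _ Ma k u 0; rewrite (vn_op0 _ Ma) !addr0.
Qed.

Lemma vn_adjoint a : M a -> exists2 b, M b & is_adjoint a b.
Proof. by case: Mvn => _ adjM _; exact: adjM. Qed.

Lemma linear_onB (V : lmodType R[i]) (f : (H -> H) -> V) a b :
  linear_on M f -> M a -> M b -> f (a - b) = f a - f b.
Proof.
by move=> lf Ma Mb; have := lf (-1) b a Mb Ma; 
  rewrite !scaleN1r ![- _ + _]addrC.
Qed.

(** Testing against the adjoint b of a gives phi(ab) = 0 with ab positive, so ab = 0 and hence a =
    0. *)
Lemma faithful_eq0 (phi : (H -> H) -> R[i]^o) a :
  is_faithful M phi -> M a -> (forall b, M b -> phi (a \o b) = 0) -> a = 0.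
Proof.
move=> fphi Ma a0; have [b Mb ab] := vn_adjoint _ Ma.
apply: (comp_adjoint_eq0 _ _ ab); apply: fphi (a0 _ Mb); first exact: vn_comp.
exact: op_ge0_comp_adjoint.
Qed.

End VonNeumannAlgebra.
End Adjoints.

(** * Schwarz inequality and multiplicativity of unital completely positive maps *)

Section MultiplicativeDomain.
Context {R : realType} {H K : hilbertSpace R}.
Context (M : set (H -> H)) (N : set (K -> K)) (T : (H -> H) -> (K -> K)).
Hypotheses (Mvn : von_neumann_algebra M) (Nvn : von_neumann_algebra N).
Hypothesis Tucp : ucp_map M N T.
Implicit Types (x y : H -> H).

(** The Gram matrix with entries [zs i \o z j] is positive, its form at v being the squared norm of
    the sum of the [z j (v j)]; complete positivity carries this over to T. *)
Lemma ucp_gram_ge0 n (z zs : 'I_n -> H -> H) (u : 'I_n -> K) :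
  (forall i, M (z i)) -> (forall i, M (zs i)) ->
  (forall i, is_adjoint (z i) (zs i)) ->
  0 <= \sum_i \sum_j inner K (T (zs i \o z j) (u j)) (u i).
Proof.
move=> Mz Mzs zzs; case: Tucp => _ _ cpT _.
have /(_ _ _ u) := cpT n (\matrix_(i, j) (zs i \o z j)).
under eq_bigr do under eq_bigr do rewrite !mxE.
apply=> [i j|v]; first by rewrite mxE; exact: vn_comp.
suff -> : \sum_i \sum_j
      inner H ((\matrix_(i, j) (zs i \o z j)) i j (v j)) (v i) =
    inner H (\sum_j z j (v j)) (\sum_i z i (v i)) by exact: dnorm_ge0.
rewrite linear_sumr; apply: eq_bigr => i _.
rewrite linear_sumlz; apply: eq_bigr => j _.
by rewrite mxE /= (is_adjoint_sym _ _ (zzs i)).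
Qed.

Lemma ucp_gram3_ge0 x xs y ys : M x -> M xs -> M y -> M ys ->
  is_adjoint x xs -> is_adjoint y ys -> forall u v w : K,
  0 <= inner K u u + inner K (T x v) u + inner K (T y w) u
     + (inner K (T xs u) v + inner K (T (xs \o x) v) v
        + inner K (T (xs \o y) w) v)
     + (inner K (T ys u) w + inner K (T (ys \o x) v) w
        + inner K (T (ys \o y) w) w).
Proof.
move=> Mx Mxs My Mys xxs yys u v w; case: (Tucp) => _ _ _ T1.
have M1 := vn_id _ Mvn.
pose z (i : 'I_3) := nth idfun [:: idfun; x; y] i.
pose zs (i : 'I_3) := nth idfun [:: idfun; xs; ys] i.
pose U (i : 'I_3) := nth 0 [:: u; v; w] i.
have := ucp_gram_ge0 3 z zs U.
rewrite !big_ord_recl !big_ord0 /z /zs /U /= !addr0 !addrA T1 => h.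
by apply: h; case=> [[|[|[|]]]].
Qed.

(** Positivity makes the Gram form of (1, x) real; removing its real diagonal terms leaves the sum
    of the two cross terms real. *)
Lemma ucp_adjoint x xs : M x -> M xs -> is_adjoint x xs ->
  is_adjoint (T x) (T xs).
Proof.
move=> Mx Mxs xxs u v.
have [TN _ _ _] := Tucp.
have T0 a : M a -> T a 0 = 0 by move=> /TN /(vn_op0 _ Nvn).
have TZ a c w : M a -> T a (c *: w) = c *: T a w.
  by move=> /TN /(vn_opZ _ Nvn).
have gram s t : 0 <= inner K s s + inner K (T x t) s
    + (inner K (T xs s) t + inner K (T (xs \o x) t) t).
  have := ucp_gram3_ge0 x xs x xs Mx Mxs Mx Mxs xxs xxs s t 0.
  by rewrite (T0 _ Mx) T0 ?linear0l ?linear0r ?addr0 //; exact: vn_comp.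
have diagR t : inner K (T (xs \o x) t) t \is Num.real.
  have := gram 0 t; rewrite T0 // !linear0l linear0r !add0r.
  exact: ger0_real.
have real2 s t : inner K (T x t) s + inner K (T xs s) t \is Num.real.
  rewrite (_ : _ + _ = inner K s s + inner K (T x t) s
    + (inner K (T xs s) t + inner K (T (xs \o x) t) t)
    - inner K s s - inner K (T (xs \o x) t) t); last by ring.
  by rewrite !rpredB // ger0_real // ?dnorm_ge0 // gram.
rewrite [RHS]innerC; apply: (canRL conjCK); apply: esym.
apply: conj_of_real; first exact: real2.
(* Replacing v by iv turns the sum of the cross terms into i times their difference, the second
   condition of [conj_of_real]. *)
have := real2 ('i *: v) u.
rewrite TZ // linearZr linearZl /= conjCi mulNr addrC -mulrBr; exact.
Qed.

Lemma ucp_mult_of_schwarz_eq x xs : M x -> M xs -> is_adjoint x xs ->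
  T (xs \o x) = T xs \o T x ->
  (forall y, M y -> T (xs \o y) = T xs \o T y) /\
  (forall y, M y -> T (y \o x) = T y \o T x).
Proof.
move=> Mx Mxs xxs xE; have [TN _ _ _] := Tucp.
have adjT a b : M a -> M b -> is_adjoint a b -> is_adjoint (T b) (T a).
  by move=> Ma Mb ab; apply: is_adjoint_sym; exact: ucp_adjoint.
have key y ys v w : M y -> M ys -> is_adjoint y ys ->
    inner K (T (ys \o x) v) w - inner K (T x v) (T y w) = 0 /\
    inner K (T (xs \o y) w) v - inner K (T y w) (T x v) = 0.
  move=> My Mys yys.
  (* The choice u = -(T x v + T y w) in the Gram form yields the form of the
     defects on (v, w); its (v, v) coefficient is zero, and v is rescaled. *)
  apply: (ge0_sesqui_affine_eq0 _ _ _
    (inner K (T (ys \o y) w) w - inner K (T y w) (T y w))) => c.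
  have TZ a t : M a -> T a (c *: t) = c *: T a t.
    by move=> /TN /(vn_opZ _ Nvn).
  have Myx : M (ys \o x) := vn_comp _ Mvn _ _ Mys Mx.
  have := ucp_gram3_ge0 x xs y ys Mx Mxs My Mys xxs yys
    (- (T x (c *: v) + T y w)) (c *: v) w.
  rewrite xE /= !(adjT x xs) // !(adjT y ys) // !TZ //.
  rewrite !(linearNl, linearNr, linearDl, linearDr) /= ?linearZl ?linearZr /=.
  by move=> /le_trans; apply; rewrite le_eqVlt; apply/orP; left; apply/eqP;
    ring.
split=> y My; have [ys Mys yys] := vn_adjoint _ Mvn _ My.
  apply/funext => w; apply: inner_eq => v /=.
  have [_ /eqP] := key y ys v w My Mys yys.
  by rewrite subr_eq0 (adjT x xs) // => /eqP.
apply/funext => v; apply: inner_eq => w /=.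
(* [y] and [ys] are exchanged, since the left factor in [key] is the adjoint of its first
   argument. *)
have [/eqP + _] := key ys y v w Mys My (is_adjoint_sym _ _ yys).
by rewrite subr_eq0 (adjT ys y) // => [/eqP//|]; exact: is_adjoint_sym.
Qed.

(** Completing the square: the Gram form of (1, x) at the vectors (-T(x)v, v) is exactly the form of
    the defect at v. *)
Lemma ucp_schwarz x xs : M x -> M xs -> is_adjoint x xs ->
  op_ge0 (T (xs \o x) - (T xs \o T x)).
Proof.
move=> Mx Mxs xxs v; have [TN _ _ _] := Tucp.
have T0 a : M a -> T a 0 = 0 by move=> /TN /(vn_op0 _ Nvn).
have xsx := is_adjoint_sym _ _ (ucp_adjoint _ _ Mx Mxs xxs).
change (0 <= inner K (T (xs \o x) v - T xs (T x v)) v).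
have := ucp_gram3_ge0 x xs x xs Mx Mxs Mx Mxs xxs xxs (- T x v) v 0.
rewrite (T0 _ Mx) !T0 ?linear0l ?linear0r ?addr0; try exact: vn_comp.
rewrite linearBl /= !xsx !(linearNl, linearNr) /= opprK subrr add0r.
by rewrite addrC.
Qed.

Lemma LMD_schwarz_eq x xs : M x -> M xs -> is_adjoint x xs ->
  LMD M T xs <-> T (xs \o x) = T xs \o T x.
Proof.
move=> Mx Mxs xxs; split=> [[_ /(_ _ Mx)]//|xE].
by split=> //; have [] := ucp_mult_of_schwarz_eq _ _ Mx Mxs xxs xE.
Qed.

Lemma RMD_schwarz_eq x xs : M x -> M xs -> is_adjoint x xs ->
  RMD M T x <-> T (xs \o x) = T xs \o T x.
Proof.
move=> Mx Mxs xxs; split=> [[_ /(_ _ Mxs)]//|xE].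
by split=> //; have [] := ucp_mult_of_schwarz_eq _ _ Mx Mxs xxs xE.
Qed.

End MultiplicativeDomain.

Theorem lemma10p1 (R : realType) (H K : hilbertSpace R)
    (M : set (H -> H)) (N : set (K -> K))
    (phi : (H -> H) -> R[i]^o) (psi : (K -> K) -> R[i]^o)
    (sphi : R -> (H -> H) -> (H -> H)) (spsi : R -> (K -> K) -> (K -> K))
    (T : (H -> H) -> (K -> K)) (Ts : (K -> K) -> (H -> H)) :
  von_neumann_algebra M -> von_neumann_algebra N ->
  normal_faithful_state M phi -> normal_faithful_state N psi ->
  modular_group M phi sphi -> modular_group N psi spsi ->
  markov_map M N phi psi sphi spsi T ->
  markov_adjoint M N phi psi T Ts ->
  [/\ LMD M T = RMD M T, RMD M T = MD M T & MD M T = Fix M (Ts \o T)].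
Proof.
move=> Mvn Nvn [[lphi _ _] _ fphi] [[lpsi _ _] _ fpsi] _ _ [Tucp psiT _]
  [Tsucp TsT].
have [TN _ _ _] := Tucp; have [TsM _ _ _] := Tsucp.
have LF : LMD M T `<=` Fix M (Ts \o T).
  move=> x [Mx xL]; split=> //=.
  have MTx : M (Ts (T x)) := TsM _ (TN _ Mx).
  apply/eqP; rewrite -subr_eq0; apply/eqP.
  apply: (faithful_eq0 _ Mvn _ _ fphi); first exact: vnB.
  move=> y My; change (phi ((Ts (T x) \o y) - (x \o y)) = 0).
  rewrite (linear_onB _ _ _ _ _ lphi); try exact: vn_comp.
  rewrite TsT //; last exact: TN.
  by rewrite -xL // psiT ?subrr //; exact: vn_comp.
have Fadj x xs : M x -> M xs -> is_adjoint x xs ->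
    Fix M (Ts \o T) x -> Fix M (Ts \o T) xs.
  move=> Mx Mxs xxs [_ /= Fx]; split=> //=.
  (* Both maps preserve adjoints, so [Ts (T xs)] and [xs] are adjoint to the same operator
     [Ts (T x) = x]. *)
  apply: (is_adjoint_unique x); last exact: is_adjoint_sym.
  rewrite -Fx; apply: is_adjoint_sym.
  apply: (ucp_adjoint _ _ _ Nvn Mvn Tsucp _ _ (TN _ Mx) (TN _ Mxs)).
  exact: (ucp_adjoint _ _ _ Mvn Nvn Tucp).
have FL : Fix M (Ts \o T) `<=` LMD M T.
  move=> x [Mx /= Fx]; have [xs Mxs xxs] := vn_adjoint _ Mvn _ Mx.
  have xsx := is_adjoint_sym _ _ xxs.
  apply/(LMD_schwarz_eq _ _ _ Mvn Nvn Tucp _ _ Mxs Mx xsx).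
  have Mxx : M (x \o xs) := vn_comp _ Mvn _ _ Mx Mxs.
  have NTT : N (T x \o T xs) := vn_comp _ Nvn _ _ (TN _ Mx) (TN _ Mxs).
  (* The defect is positive by the Schwarz inequality, so it suffices that psi vanishes on it. *)
  apply/eqP; rewrite -subr_eq0; apply/eqP; apply: fpsi.
  - exact: (vnB _ Nvn _ _ (TN _ Mxx)).
  - exact: (ucp_schwarz _ _ _ Mvn Nvn Tucp).
  rewrite (linear_onB _ _ _ _ _ lpsi) //; last exact: TN.
  by rewrite psiT // -TsT // ?Fx ?subrr //; exact: TN.
have LR x xs : M x -> M xs -> is_adjoint x xs -> LMD M T xs <-> RMD M T x.
  move=> Mx Mxs xxs; rewrite (LMD_schwarz_eq _ _ _ Mvn Nvn Tucp x xs) //.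
  by rewrite (RMD_schwarz_eq _ _ _ Mvn Nvn Tucp x xs).
have LE : LMD M T = Fix M (Ts \o T) by apply/seteqP.
have RE : RMD M T = LMD M T.
  (* [LR] passes from one side to the other only through the adjoint; [Fadj] undoes this passage on
     the fixed points. *)
  rewrite LE; apply/seteqP; split=> x xR; have [Mx _] := xR;
    have [xs Mxs xxs] := vn_adjoint _ Mvn _ Mx.
    apply: (Fadj xs) => //; first exact: is_adjoint_sym.
    by rewrite -LE; apply/(LR x xs).
  by apply/(LR x xs) => //; rewrite LE; exact: (Fadj x).
by rewrite /MD RE setIid LE.
Qed.
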